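(* Let $\mathcal{D}$ be the space of states of a finite-dimensional quantum open system with a Markovian evolution with Kossakowski-Lindblad vector field $Z_L$ and flow $\Phi_t^L$, and let $\Lambda_{\mathcal{D},t}=\Phi^L_{t*}\Lambda_{\mathcal{D}}$, $R_{\mathcal{D},t}=\Phi^L_{t*}R_{\mathcal{D}}$, $t\ge0$. Suppose that the limits $\Lambda_{\mathcal{D},\infty}=\lim_{t\to\infty}\Lambda_{\mathcal{D},t}$ and $R_{\mathcal{D},\infty}=\lim_{t\to\infty}R_{\mathcal{D},t}$ exist. Then the set $\mathcal{E}_{\mathcal{D}}$ of expectation value functions on $\mathcal{D}$ is a Lie-Jordan algebra with respect to the products $$\{e_a,e_b\}_\infty(\rho)=\Lambda_{\mathcal{D},\infty}(\mathrm{d}e_a,\mathrm{d}e_b)(\rho),\qquad(e_a,e_b)_\infty(\rho)=R_{\mathcal{D},\infty}(\mathrm{d}e_a,\mathrm{d}e_b)(\rho)+e_a(\rho)e_b(\rho),\qquad\rho\in\mathcal{D}.$$ This algebra gives rise to an associative complex algebra (on the complexification of $\mathcal{E}_{\mathcal{D}}$, extending complex-bilinearly) with respect to the product $$e_a*_\infty e_b=(e_a,e_b)_\infty+i\{e_a,e_b\}_\infty,\qquad a,b\in\mathcal{O}.$$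
   Context: $\mathcal{H}$ is a complex Hilbert space of finite dimension $n$; $\mathcal{O}=\mathrm{Herm}(\mathcal{H})$ with $[[a,b]]=-\frac{i}{2}(ab-ba)$ and $a\odot b=\frac12(ab+ba)$. $\mathcal{D}$ is the set of density operators, $e_a(\rho)=\mathrm{tr}(\rho a)$ for $a\in\mathcal{O}$, and $\mathcal{E}_{\mathcal{D}}=\{e_a:a\in\mathcal{O}\}$. Differential calculus on $\mathcal{D}$ is that of the affine hyperplane $\{\xi\in\mathrm{Herm}(\mathcal{H}):\mathrm{tr}\,\xi=1\}$ containing it, on which all tensor fields below are defined by the same formulas. $\Lambda_{\mathcal{D}}$ and $R_{\mathcal{D}}$ are the $(2,0)$-tensor fields determined by $\Lambda_{\mathcal{D}}(\mathrm{d}e_a,\mathrm{d}e_b)=e_{[[a,b]]}$ and $R_{\mathcal{D}}(\mathrm{d}e_a,\mathrm{d}e_b)=e_{a\odot b}-e_ae_b$. A Markovian evolution is given by a Kossakowski-Lindblad operator $L(\rho)=-i[H,\rho]-\frac12\sum_{j=1}^{n^2-1}(V_j^*V_j\rho+\rho V_j^*V_j)+\sum_{j=1}^{n^2-1}V_j\rho V_j^*$ with $H^*=H$, $\mathrm{tr}\,H=0$, $\mathrm{tr}\,V_j=0$, and $\mathrm{tr}(V_j^*V_k)=0$ for $j\ne k$. $Z_L$ is the vector field $\rho\mapsto L(\rho)$, with flow $\Phi^L_t=e^{tL}$; $\Phi^L_{t*}$ denotes push-forward. Limits of tensor fields are taken pointwise on $\mathcal{D}$. A Lie-Jordan algebra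 is a real vector space with a Lie bracket $[[\cdot,\cdot]]$ and a Jordan product $\odot$ (symmetric bilinear with $(a\odot b)\odot(a\odot a)=a\odot(b\odot(a\odot a))$) such that each $[[a,\cdot]]$ is a derivation of $\odot$ and $a\odot(b\odot c)-(a\odot b)\odot c=\mu^2\left([[a,[[b,c]]]]-[[[[a,b]],c]]\right)$ for some real $\mu\ne0$. *)

(* Defs.v *)
From HB Require Import structures.
From mathcomp Require Import all_boot all_order all_algebra.
From mathcomp Require Import sesquilinear spectral complex ring lra.
From mathcomp Require Import all_classical all_reals all_analysis.

Set Implicit Arguments.
Unset Strict Implicit.
Unset Printing Implicit Defensive.

Import Order.TTheory GRing.Theory Num.Theory.
Import numFieldNormedType.Exports.

Local Open Scope classical_set_scope.
Local Open Scope ring_scope.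
Local Open Scope sesquilinear_scope.
Local Open Scope complex_scope.

(* The Hilbert space is C^n with its standard inner product, so operators are
   n x n matrices over R[i] and the adjoint of A is A ^t*; `hermsymmx` is the
   set Herm(C^n) of observables. *)

Section Observables.
Variables (R : realType) (n : nat).
Local Notation mx := 'M[R[i]]_n.

Definition lie_mx (a b : mx) : mx := (- ('i / 2)) *: (a *m b - b *m a).

Definition jordan_mx (a b : mx) : mx := (1 / 2) *: (a *m b + b *m a).

Definition observable := {a : mx | a \is hermsymmx}.

(* The trace is real when xi and a are Hermitian, the only case of interest. *)
Definition expect (a xi : mx) : R := complex.Re (\tr (xi *m a)).

Definition is_density (rho : mx) : Prop :=
  [/\ rho \is hermsymmx,
      forall v : 'cV[R[i]]_n, 0 <= (v ^t* *m rho *m v) 0 0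
    & \tr rho = 1].

Definition density := {rho : mx | is_density rho}.

Definition hyperplane : set mx := [set xi | xi \is hermsymmx /\ \tr xi = 1].

Definition tangent : set mx := [set v | v \is hermsymmx /\ \tr v = 0].

End Observables.

(* Tensor fields on the hyperplane.  All its tangent spaces are the space of
   traceless Hermitian matrices.  A covector is encoded by a function on
   matrices of which only the values on tangent vectors matter. *)
Section Tensors.
Variables (R : realType) (n : nat).
Local Notation mx := 'M[R[i]]_n.

Definition covec := mx -> R.

Definition is_covector (alpha : covec) : Prop :=
  forall (c : R) (u v : mx), tangent u -> tangent v ->
    alpha (c%:C *: u + v) = c * alpha u + alpha v.

(* e_a is the restriction of a real-linear form to the hyperplane, so its
   differential is, at every point, the restriction of that same form to the
   tangent vectors. *)
Definition d_expect (a : mx) : covec := fun v => expect a v.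

Definition tensor20 := mx -> covec -> covec -> R.

(* Every covector is d_expect a for some Hermitian a, unique up to addition of
   a real multiple of the identity. *)
Definition potential (alpha : covec) : mx :=
  xget 0 [set a | a \is hermsymmx /\
                  forall v, tangent v -> alpha v = d_expect a v].

Definition Lambda_D : tensor20 := fun xi alpha beta =>
  expect (lie_mx (potential alpha) (potential beta)) xi.

Definition R_D : tensor20 := fun xi alpha beta =>
  expect (jordan_mx (potential alpha) (potential beta)) xi
    - expect (potential alpha) xi * expect (potential beta) xi.

(* phi is a linear bijection with inverse phi'; being linear, it is its own
   differential at every point. *)
Definition pushforward (phi phi' : mx -> mx) (T : tensor20) : tensor20 :=
  fun xi alpha beta => T (phi' xi) (alpha \o phi) (beta \o phi).

Definition tensor_cvg (T : R -> tensor20) (Tinf : tensor20) : Prop :=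
  forall rho, is_density rho -> forall alpha beta : covec,
    is_covector alpha -> is_covector beta ->
    T t rho alpha beta @[t --> +oo] --> Tinf rho alpha beta.

End Tensors.

Section TensorsTheory.
Variables (R : realType) (n : nat).
Local Notation mx := 'M[R[i]]_n.
Implicit Types a b c xi u v : mx.

Lemma hermP a : reflect (a ^t* = a) (a \is hermsymmx).
Proof.
rewrite qualifE /= expr0 scale1r eq_sym; exact: eqP.
Qed.

Lemma expectDl a b xi : expect (a + b) xi = expect a xi + expect b xi.
Proof. by rewrite /expect mulmxDr !raddfD. Qed.

Lemma expectZl (r : R) a xi : expect (r%:C *: a) xi = r * expect a xi.
Proof.
by rewrite /expect -scalemxAr mxtraceZ; case: (\tr _) => x y /=; rewrite mul0r subr0.
Qed.

Lemma expect1 xi : \tr xi = 1 -> expect 1%:M xi = 1.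
Proof. by rewrite /expect mulmx1 => ->. Qed.

Lemma herm_sqr0 v : v \is hermsymmx -> expect v v = 0 -> v = 0.
Proof.
move=> /hermP hv h0.
have h1 : \tr (v *m v) = \sum_i \sum_j `|v i j| ^+ 2.
  rewrite /mxtrace; apply: eq_bigr => i _; rewrite mxE; apply: eq_bigr => j _.
  by rewrite -{2}hv !mxE -normCK.
have h2 i : 0 <= \sum_j `|v i j| ^+ 2.
  by apply: sumr_ge0 => j _; rewrite exprn_ge0.
have h3 : \tr (v *m v) = 0.
  have : 0 <= \tr (v *m v) by rewrite h1; apply: sumr_ge0.
  move: h0; rewrite /expect; case: (\tr _) => x y /= ->.
  by rewrite lecE /= => /andP[/eqP -> _].
apply/matrixP => i j; rewrite mxE; apply/eqP.
have /psumr_eq0P h4 : \sum_i \sum_j `|v i j| ^+ 2 = 0 by rewrite -h1.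
have /psumr_eq0P h5 := h4 (fun i _ => h2 i) i isT.
have := h5 (fun k _ => exprn_ge0 2 (normr_ge0 _)) j isT.
by move=> /eqP; rewrite sqrf_eq0 normr_eq0.
Qed.

Lemma herm_trace a : a \is hermsymmx -> \tr a = (complex.Re (\tr a))%:C.
Proof.
move=> /hermP ha.
have : conjc (\tr a) = \tr a.
  rewrite -{2}ha /mxtrace (raddf_sum conjc); apply: eq_bigr => i _.
  by rewrite !mxE.
case: (\tr a) => x y /= [] hy; congr (_ +i* _); lra.
Qed.

Lemma herm_scalar (r : R) : (r%:C%:M : mx) \is hermsymmx.
Proof.
apply/hermP/matrixP => i j; rewrite !mxE eq_sym.
have h : Num.conj (r%:C : R[i]) = r%:C by congr (_ +i* _); rewrite oppr0.
by case: (i == j); rewrite ?mulr1n ?mulr0n ?rmorph0.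
Qed.

Lemma conj_real (r : R) : Num.conj (r%:C : R[i]) = r%:C.
Proof. by congr (_ +i* _); rewrite oppr0. Qed.

Lemma adjD u v : (u + v) ^t* = u ^t* + v ^t*.
Proof. by apply/matrixP => i j; rewrite !mxE rmorphD. Qed.

Lemma adjZ (z : R[i]) v : (z *: v) ^t* = Num.conj z *: v ^t*.
Proof. by apply/matrixP => i j; rewrite !mxE rmorphM. Qed.

Lemma adj_linear (r : R) u v : (r%:C *: u + v) ^t* = r%:C *: u ^t* + v ^t*.
Proof. by rewrite adjD adjZ conj_real. Qed.

Lemma herm0 : (0 : mx) \is hermsymmx.
Proof. by have := herm_scalar 0; rewrite raddf0. Qed.

Lemma hermDZ (r : R) a b : a \is hermsymmx -> b \is hermsymmx ->
  r%:C *: a + b \is hermsymmx.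
Proof. by move=> /hermP ha /hermP hb; apply/hermP; rewrite adj_linear ha hb. Qed.

Lemma hermB a b : a \is hermsymmx -> b \is hermsymmx -> a - b \is hermsymmx.
Proof.
move=> /hermP ha /hermP hb; apply/hermP.
by rewrite linearB /= map_mxB ha hb.
Qed.

Lemma d_expect_inj a b : a \is hermsymmx -> b \is hermsymmx ->
  (forall v, tangent v -> d_expect a v = d_expect b v) ->
  exists r : R, a = b + r%:C%:M.
Proof.
move=> ha hb hab.
have [n0|n_gt0] := posnP n.
  by exists 0; apply/matrixP => i; have := ltn_ord i; rewrite {2}n0.
have hc := hermB ha hb; pose c := a - b.
pose r := complex.Re (\tr c) / n%:R; exists r.
pose v := c - r%:C%:M.
have tv : tangent v.
  split; first exact: hermB hc (herm_scalar r).
  rewrite raddfB /= mxtrace_scalar (herm_trace hc) -/c /r -(rmorphMn (real_complex R)).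
  by rewrite -[_ *+ n]mulr_natr divfK ?subrr // pnatr_eq0 -lt0n.
suff v0 : v = 0.
  by apply/eqP; rewrite addrC -subr_eq -/c -subr_eq0 -[_ - _]/v v0.
apply: herm_sqr0; first by case: tv.
have -> : v = a + (-1)%:C *: b + (- r)%:C *: 1%:M.
  by rewrite /v /c !rmorphN scaleN1r scaleNr scalemx1.
rewrite expectDl expectDl !expectZl.
have -> : a + (-1)%:C *: b + (- r)%:C *: 1%:M = v.
  by rewrite /v /c !rmorphN scaleN1r scaleNr scalemx1.
have -> : expect a v = expect b v by exact: hab.
rewrite {3}/expect mulmx1; case: tv => _ -> /=; lra.
Qed.

Lemma potential_d_expect a : a \is hermsymmx ->
  exists r : R, potential (d_expect a) = a + r%:C%:M.
Proof.
move=> ha; rewrite /potential; case: xgetP => [b -> [hb hab]|/(_ a) []] //.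
by apply: d_expect_inj => // v /hab ->.
Qed.

Lemma covector_d_expect (alpha : covec R n) : is_covector alpha ->
  exists2 a : mx, a \is hermsymmx &
    forall v, tangent v -> alpha v = d_expect a v.
Proof.
move=> ha.
pose h v : mx := (2^-1)%:C *: (v + v ^t*).
pose p v : mx := v - (complex.Re (\tr v) / n%:R)%:C%:M.
have hD r u v : h (r%:C *: u + v) = r%:C *: h u + h v.
  rewrite /h adj_linear.
  rewrite addrACA -scalerDr [LHS]scalerDr !scalerA; congr (_ *: _ + _).
  exact: mulrC.
have pD r u v : p (r%:C *: u + v) = r%:C *: p u + p v.
  rewrite /p raddfD /= linearZ /=.
  have -> : complex.Re (r%:C * \tr u + \tr v) =
      r * complex.Re (\tr u) + complex.Re (\tr v).
    by case: (\tr u) (\tr v) => [x y] [z w] /=; rewrite mul0r subr0.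
  rewrite mulrDl -mulrA !(rmorphD (real_complex R)) rmorphM raddfD /=.
  rewrite -scale_scalar_mx scalerBr opprD addrACA //.
have h_herm v : h v \is hermsymmx.
  by apply/hermP; rewrite /h adjZ adjD trmxCK addrC conj_real.
have p_tan v : v \is hermsymmx -> tangent (p v).
  move=> hv; split; first exact: hermB hv (herm_scalar _).
  rewrite /p raddfB /= mxtrace_scalar {1}(herm_trace hv).
  rewrite -(rmorphMn (real_complex R)) -[_ *+ n]mulr_natr.
  have [n0|n_gt0] := posnP n; last first.
    by rewrite divfK ?subrr // pnatr_eq0 -lt0n.
  have -> : \tr v = 0.
    by rewrite /mxtrace big1 // => i; have := ltn_ord i; rewrite {2}n0.
  by rewrite mul0r mul0r subrr.
pose G v := alpha (p (h v)).
have GD r u v : G (r%:C *: u + v) = r * G u + G v.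
  by rewrite /G hD pD ha //; apply: p_tan.
have G0 : G 0 = 0.
  by have := GD 1 0 0; rewrite mul1r scaler0 addr0 => h0; lra.
have Gadd : {morph G : u v / u + v}.
  by move=> u v; have := GD 1 u v; rewrite mul1r scale1r.
have GZ r u : G (r%:C *: u) = r * G u.
  by have := GD r u 0; rewrite !addr0 G0 addr0.
have Gadj v : G (v ^t*) = G v by rewrite /G /h trmxCK addrC.
have Gtan v : tangent v -> G v = alpha v.
  move=> [hv tv]; congr alpha.
  have -> : h v = v.
    rewrite /h (hermP _ hv); apply/matrixP => i j; rewrite !mxE.
    by case: (v i j) => x y; congr (_ +i* _) => /=; field.
  by rewrite /p tv mul0r raddf0 subr0.
pose e j k : mx := delta_mx j k.
pose a : mx := \matrix_(k, j) (G (e j k) -i* G ('i *: e j k)).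
have e_adj j k : (e j k) ^t* = e k j.
  by rewrite /e trmx_delta map_delta_mx.
exists a.
  have Ge j k : G (e k j) = G (e j k) by rewrite -e_adj Gadj.
  have Gie j k : G ('i *: e k j) = - G ('i *: e j k).
    rewrite -[in LHS]Gadj adjZ e_adj.
    have -> : Num.conj ('i : R[i]) = (-1)%:C * 'i by congr (_ +i* _) => /=; ring.
    by rewrite -scalerA GZ mulN1r.
  apply/hermP/matrixP => k j; rewrite !mxE Ge Gie.
  by congr (_ +i* _); rewrite /= !opprK.
move=> v /Gtan <-.
have vE : v = \sum_j \sum_k
    ((complex.Re (v j k))%:C *: e j k + (complex.Im (v j k))%:C *: ('i *: e j k)).
  rewrite {1}(matrix_sum_delta v); apply: eq_bigr => j _; apply: eq_bigr => k _.
  rewrite scalerA -scalerDl; congr (_ *: _).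
  by case: (v j k) => x y; congr (_ +i* _) => /=; ring.
rewrite /d_expect /expect /mxtrace {1}vE (big_morph G Gadd G0).
rewrite (raddf_sum (@complex.Re R)); apply: eq_bigr => j _.
rewrite (big_morph G Gadd G0) mxE (raddf_sum (@complex.Re R)).
apply: eq_bigr => k _; rewrite Gadd !GZ mxE.
by case: (v j k) => x y /=; rewrite mulrN opprK.
Qed.

Lemma Lambda_DE a b xi : a \is hermsymmx -> b \is hermsymmx -> hyperplane xi ->
  Lambda_D xi (d_expect a) (d_expect b) = expect (lie_mx a b) xi.
Proof.
move=> ha hb _; rewrite /Lambda_D.
have [r ->] := potential_d_expect ha; have [s ->] := potential_d_expect hb.
suff -> : lie_mx (a + r%:C%:M) (b + s%:C%:M) = lie_mx a b by [].
rewrite /lie_mx !(mulmxDl, mulmxDr) !mul_scalar_mx !mul_mx_scalar.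
move: r%:C s%:C (- ('i / 2) : R[i]) => p q z.
apply/matrixP => i j; rewrite !mxE.
move: ((a *m b) i j) ((b *m a) i j) (a i j) (b i j) (i == j) => x y x' y' e.
ring.
Qed.

Lemma R_DE a b xi : a \is hermsymmx -> b \is hermsymmx -> hyperplane xi ->
  R_D xi (d_expect a) (d_expect b)
    = expect (jordan_mx a b) xi - expect a xi * expect b xi.
Proof.
move=> ha hb [_ tr1]; rewrite /R_D.
have [r ->] := potential_d_expect ha; have [s ->] := potential_d_expect hb.
have -> : jordan_mx (a + r%:C%:M) (b + s%:C%:M) =
  jordan_mx a b + r%:C *: b + s%:C *: a + (r * s)%:C *: 1%:M.
  rewrite /jordan_mx !(mulmxDl, mulmxDr) !mul_scalar_mx !mul_mx_scalar.
  rewrite rmorphM /=; move: r%:C s%:C => p q; apply/matrixP => i j; rewrite !mxE.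
  move: ((a *m b) i j) ((b *m a) i j) (a i j) (b i j) (i == j) => x y x' y' e.
  by field.
rewrite -(scalemx1 _ r%:C) -(scalemx1 _ s%:C) !expectDl !expectZl expect1 //.
ring.
Qed.

End TensorsTheory.

Section Dynamics.
Variables (R : realType) (n : nat).
Local Notation mx := 'M[R[i]]_n.

Definition kossakowski_lindblad (H : mx) (V : 'I_(n ^ 2 - 1) -> mx) (rho : mx)
    : mx :=
  (- 'i) *: (H *m rho - rho *m H)
  - (1 / 2) *: \sum_j ((V j) ^t* *m V j *m rho + rho *m (V j) ^t* *m V j)
  + \sum_j (V j *m rho *m (V j) ^t*).

(* Entrywise limit: R[i] carries no topology in the libraries. *)
Definition lim_mx (u : nat -> mx) : mx := \matrix_(i, j)
  (lim ((fun N => complex.Re (u N i j)) @ \oo)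
   +i* lim ((fun N => complex.Im (u N i j)) @ \oo)).

(* e^{tL}, whose inverse is e^{-tL} *)
Definition flow (L : mx -> mx) (t : R) (rho : mx) : mx :=
  lim_mx (fun N => \sum_(k < N) (t ^+ k / k`!%:R)%:C *: iter k L rho).

Definition flow_pushforward (L : mx -> mx) (T : tensor20 R n) (t : R)
    : tensor20 R n :=
  pushforward (flow L t) (flow L (- t)) T.

End Dynamics.

Definition bilinear_map (K : pzRingType) (U V W : lmodType K)
    (f : U -> V -> W) : Prop :=
  (forall u, linear (f u)) /\ (forall v, linear (f^~ v)).

Section LieJordan.
Variables (R : realType) (V : lmodType R).

Record is_lie_jordan (lie jor : V -> V -> V) : Prop := IsLieJordan {
  lie_bilinear : bilinear_map lie;
  lie_alternating : forall a, lie a a = 0;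
  lie_jacobi : forall a b c,
    lie a (lie b c) + lie b (lie c a) + lie c (lie a b) = 0;
  jordan_bilinear : bilinear_map jor;
  jordan_comm : forall a b, jor a b = jor b a;
  jordan_identity : forall a b,
    jor (jor a b) (jor a a) = jor a (jor b (jor a a));
  lie_derivation : forall a b c,
    lie a (jor b c) = jor (lie a b) c + jor b (lie a c);
  lie_jordan_associator : exists2 mu : R, mu != 0 & forall a b c,
    jor a (jor b c) - jor (jor a b) c
      = mu ^+ 2 *: (lie a (lie b c) - lie (lie a b) c) }.

(* The pair (x, y) stands for x + i y. *)
Definition complexification : Type := (V * V)%type.

HB.instance Definition _ := GRing.Zmodule.on complexification.

Definition complexification_scale (z : R[i]) (x : complexification)
    : complexification :=
  (complex.Re z *: x.1 - complex.Im z *: x.2,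
   complex.Re z *: x.2 + complex.Im z *: x.1).

Lemma complexification_scaleA z w x :
  complexification_scale z (complexification_scale w x)
    = complexification_scale (z * w) x.
Proof.
case: z w x => [a b] [c d] [x y]; rewrite /complexification_scale /=.
rewrite !(scalerDr, scalerDl, scalerN, scalerA).
by congr pair; rewrite !(scaleNr, opprD, opprK) -!addrA; congr (_ + _);
  rewrite [RHS]addrC -addrA.
Qed.

Lemma complexification_scale1 : left_id 1 complexification_scale.
Proof.
by case=> x y; rewrite /complexification_scale /= !scale1r !scale0r subr0 addr0.
Qed.

Lemma complexification_scaleDr :
  right_distributive complexification_scale +%R.
Proof.
move=> [a b] [x y] [x' y']; rewrite /complexification_scale /=.
by congr pair; rewrite /= !scalerDr ?opprD addrACA.
Qed.

Lemma complexification_scaleDl x :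
  {morph complexification_scale^~ x : z w / z + w}.
Proof.
case: x => x y [a b] [c d]; rewrite /complexification_scale /=.
by congr pair; rewrite /= !scalerDl ?opprD addrACA.
Qed.

HB.instance Definition _ := GRing.Zmodule_isLmodule.Build R[i] complexification
  complexification_scaleA complexification_scale1
  complexification_scaleDr complexification_scaleDl.

Definition complexify (x : V) : complexification := (x, 0).

(* The complex-bilinear extension of (x, y) |-> jor x y + i lie x y makes the
   complexification an associative algebra; the extension is unique. *)
Definition gives_associative_algebra (lie jor : V -> V -> V) : Prop :=
  exists star : complexification -> complexification -> complexification,
  [/\ bilinear_map star,
      forall x y, star (complexify x) (complexify y)
        = complexify (jor x y) + 'i *: complexify (lie x y)
    & associative star].

End LieJordan.

Section Expectations.
Variables (R : realType) (n : nat).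

Definition is_expectation : {pred density R n -> R} :=
  fun f => `[< exists a : observable R n,
                 forall rho, f rho = expect (sval a) (sval rho) >].

Fact is_expectation_submod : submod_closed is_expectation.
Proof.
split.
  apply/asboolP; exists (exist _ 0 (herm0 R n)) => rho /=.
  by rewrite /expect mulmx0 mxtrace0.
move=> r f g /asboolP[a fE] /asboolP[b gE]; apply/asboolP.
exists (exist _ (r%:C *: sval a + sval b) (hermDZ r (svalP a) (svalP b))) => rho /=.
by rewrite expectDl expectZl -fE -gE.
Qed.

HB.instance Definition _ :=
  GRing.isSubmodClosed.Build R (density R n -> R) is_expectation is_expectation_submod.

Record expectations := Expectations {
  expectation_fun :> density R n -> R;
  _ : expectation_fun \in is_expectation }.

HB.instance Definition _ := [isSub for expectation_fun].
HB.instance Definition _ := [Choice of expectations by <:].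
HB.instance Definition _ := [SubChoice_isSubLmodule of expectations by <:].

Fact expectation_subproof (a : observable R n) :
  (fun rho : density R n => expect (sval a) (sval rho)) \in is_expectation.
Proof. by apply/asboolP; exists a. Qed.

Definition expectation_of (a : observable R n) : expectations :=
  Expectations (expectation_subproof a).

End Expectations.

(* Main.v *)
Require Import Defs.
From HB Require Import structures.
From mathcomp Require Import all_boot all_order all_algebra.
From mathcomp Require Import sesquilinear spectral complex ring lra.
From mathcomp Require Import all_classical all_reals all_analysis.

Set Implicit Arguments.
Unset Strict Implicit.
Unset Printing Implicit Defensive.

Import Order.TTheory GRing.Theory Num.Theory.
Import numFieldNormedType.Exports.

Local Open Scope classical_set_scope.
Local Open Scope ring_scope.
Local Open Scope sesquilinear_scope.
Local Open Scope complex_scope.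

(* Let A_t be the dual of the flow for the trace pairing (the Heisenberg picture).
   Pushing Lambda_D and R_D forward along the flow turns the brackets at time t into
   the antisymmetric and symmetric parts of the product
   a *_t b = A_{-t}(A_t a * A_t b), which is associative because A_{-t} inverts A_t.
   Density matrices span all matrices, so convergence of the two tensors on densities
   gives entrywise convergence of *_t; associativity, bilinearity and compatibility
   with the adjoint pass to the limit.  The symmetrized products of an associative
   *-algebra satisfy the Lie-Jordan identities (with mu = 1), and the complexified
   expectation functions are identified with the algebra of all matrices under the
   limit product. *)

(** * Componentwise limits of complex numbers and matrices along a filter *)

Section ComplexLimits.
Variables (R : realType) (T : Type) (F : set_system T).
Context {FF : ProperFilter F}.
Implicit Types (u v : T -> R[i]) (z w : R[i]).

(* R[i] carries no topology, so limits are taken componentwise. *)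
Definition ccvg u z : Prop :=
  (complex.Re (u t) @[t --> F] --> complex.Re z) /\
  (complex.Im (u t) @[t --> F] --> complex.Im z).

Lemma ccvg_cst z : ccvg (fun=> z) z.
Proof. by split; exact: cvg_cst. Qed.

Lemma ccvgD u v z w : ccvg u z -> ccvg v w -> ccvg (fun t => u t + v t) (z + w).
Proof.
by move=> [? ?] [? ?]; split; under eq_fun do rewrite raddfD /=;
  rewrite raddfD; exact: cvgD.
Qed.

Lemma ccvgM u v z w : ccvg u z -> ccvg v w -> ccvg (fun t => u t * v t) (z * w).
Proof.
have ReM (x y : R[i]) : complex.Re (x * y) =
    complex.Re x * complex.Re y - complex.Im x * complex.Im y.
  by case: x y => ? ? [].
have ImM (x y : R[i]) : complex.Im (x * y) =
    complex.Re x * complex.Im y + complex.Im x * complex.Re y.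
  by case: x y => ? ? [].
move=> [? ?] [? ?]; split.
  by under eq_fun do rewrite ReM; rewrite ReM; apply: cvgB; exact: cvgM.
by under eq_fun do rewrite ImM; rewrite ImM; apply: cvgD; exact: cvgM.
Qed.

Lemma ccvgZ z u w : ccvg u w -> ccvg (fun t => z * u t) (z * w).
Proof. exact/ccvgM/ccvg_cst. Qed.

Lemma ccvg_conj u z : ccvg u z -> ccvg (fun t => Num.conj (u t)) (Num.conj z).
Proof.
have ReC (x : R[i]) : complex.Re (Num.conj x) = complex.Re x by case: x.
have ImC (x : R[i]) : complex.Im (Num.conj x) = - complex.Im x by case: x.
move=> [? ?]; split; first by under eq_fun do rewrite ReC; rewrite ReC.
by under eq_fun do rewrite ImC; rewrite ImC; exact: cvgN.
Qed.

Lemma ccvg_sum (I : finType) (u : I -> T -> R[i]) (z : I -> R[i]) :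
  (forall i, ccvg (u i) (z i)) -> ccvg (fun t => \sum_i u i t) (\sum_i z i).
Proof.
move=> uz; elim: (index_enum I) => [|i s ih].
  by under eq_fun do rewrite big_nil; rewrite big_nil; exact: ccvg_cst.
by under eq_fun do rewrite big_cons; rewrite big_cons; exact: ccvgD.
Qed.

Lemma ccvg_unique u z w : ccvg u z -> ccvg u w -> z = w.
Proof.
case: z w => [a b] [c d] [/= h1 h2] [/= h3 h4].
by congr Complex; [apply: cvg_unique h1 h3|apply: cvg_unique h2 h4].
Qed.

Definition mcvg m n (A : T -> 'M[R[i]]_(m, n)) (B : 'M[R[i]]_(m, n)) : Prop :=
  forall i j, ccvg (fun t => A t i j) (B i j).

Lemma mcvg_cst m n (B : 'M[R[i]]_(m, n)) : mcvg (fun=> B) B.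
Proof. by move=> i j; exact: ccvg_cst. Qed.

Lemma mcvgD m n (A1 A2 : T -> 'M[R[i]]_(m, n)) B1 B2 :
  mcvg A1 B1 -> mcvg A2 B2 -> mcvg (fun t => A1 t + A2 t) (B1 + B2).
Proof.
by move=> h1 h2 i j; under eq_fun do rewrite mxE; rewrite mxE; exact: ccvgD.
Qed.

Lemma mcvgZ m n u z (A : T -> 'M[R[i]]_(m, n)) B :
  ccvg u z -> mcvg A B -> mcvg (fun t => u t *: A t) (z *: B).
Proof.
by move=> h1 h2 i j; under eq_fun do rewrite mxE; rewrite mxE; exact: ccvgM.
Qed.

Lemma mcvgM m n p (A1 : T -> 'M[R[i]]_(m, n)) (A2 : T -> 'M[R[i]]_(n, p)) B1 B2 :
  mcvg A1 B1 -> mcvg A2 B2 -> mcvg (fun t => A1 t *m A2 t) (B1 *m B2).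
Proof.
move=> h1 h2 i j; under eq_fun do rewrite mxE; rewrite mxE.
by apply: ccvg_sum => k; exact: ccvgM.
Qed.

Lemma mcvg_sum m n (I : finType) (A : I -> T -> 'M[R[i]]_(m, n)) B :
  (forall i, mcvg (A i) (B i)) -> mcvg (fun t => \sum_i A i t) (\sum_i B i).
Proof.
move=> h i j; under eq_fun do rewrite summxE; rewrite summxE.
by apply: ccvg_sum => k; exact: h.
Qed.

Lemma mcvg_trace n (A : T -> 'M[R[i]]_n) B :
  mcvg A B -> ccvg (fun t => \tr (A t)) (\tr B).
Proof. by move=> h; apply: ccvg_sum => i; exact: h. Qed.

Lemma mcvg_adj n (A : T -> 'M[R[i]]_n) B :
  mcvg A B -> mcvg (fun t => (A t) ^t*) (B ^t*).
Proof.
move=> h i j; under eq_fun do rewrite !mxE; rewrite !mxE.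
exact/ccvg_conj/h.
Qed.

Lemma mcvg_unique m n (A : T -> 'M[R[i]]_(m, n)) B C :
  mcvg A B -> mcvg A C -> B = C.
Proof. by move=> h1 h2; apply/matrixP => i j; exact: ccvg_unique (h1 i j) (h2 i j). Qed.

End ComplexLimits.

(** * Cauchy products of exponential partial sums *)

Lemma sum_triangle (W : nmodType) (f : nat -> nat -> W) N :
  \sum_(k < N) \sum_(l < N - k) f k l = \sum_(m < N) \sum_(k < m.+1) f k (m - k)%N.
Proof.
elim: N => [|N ih]; first by rewrite !big_ord0.
rewrite [RHS]big_ord_recr /= -ih [LHS]big_ord_recr /= subSnn big_ord1.
rewrite [X in _ = _ + X]big_ord_recr /= subnn addrA -big_split /=; congr (_ + _).
by apply: eq_bigr => k _; rewrite subSn 1?ltnW // big_ord_recr.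
Qed.

Section CauchySum.
Variable R : realType.
Implicit Types (z w : R[i]).

(** The l1 norm on the plane. It takes values in [R], is submultiplicative and bounds both
    components, so complex series can be compared with real ones. *)
Definition norm1 z : R := `|complex.Re z| + `|complex.Im z|.

Lemma norm1_ge0 z : 0 <= norm1 z. Proof. exact: addr_ge0. Qed.

Lemma norm1D z w : norm1 (z + w) <= norm1 z + norm1 w.
Proof.
rewrite /norm1 !raddfD /= addrACA; apply: lerD; exact: ler_normD.
Qed.

Lemma norm1M z w : norm1 (z * w) <= norm1 z * norm1 w.
Proof.
case: z w => [a b] [c d]; rewrite /norm1 /=.
have := ler_normB (a * c) (b * d); have := ler_normD (a * d) (b * c).
rewrite !normrM; nra.
Qed.

Lemma norm1R (x : R) z : norm1 (x%:C * z) = `|x| * norm1 z.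
Proof. by case: z => a b; rewrite /norm1 /= !mul0r subr0 addr0 !normrM mulrDr. Qed.

Lemma norm1_sum (I : finType) (z : I -> R[i]) (P : pred I) :
  norm1 (\sum_(i | P i) z i) <= \sum_(i | P i) norm1 (z i).
Proof.
elim/big_rec2: _ => [|i x y _ h]; first by rewrite /norm1 /= normr0 addr0.
exact: le_trans (norm1D _ _) (lerD _ _).
Qed.

Lemma ccvg_norm1_le (u : nat -> R[i]) z (e : nat -> R) :
  (\forall N \near \oo, norm1 (u N - z) <= e N) -> e @ \oo --> 0 -> ccvg \oo u z.
Proof.
move=> ue e0; split.
  apply/cvgrPdist_le => d d0; move/cvgrPdist_le: e0 => /(_ _ d0).
  apply: filterS2 ue => N ue; rewrite sub0r normrN => h.
  rewrite distrC; apply: le_trans (le_trans (ler_norm _) h).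
  by apply: le_trans ue; rewrite /norm1 raddfB /= lerDl.
apply/cvgrPdist_le => d d0; move/cvgrPdist_le: e0 => /(_ _ d0).
apply: filterS2 ue => N ue; rewrite sub0r normrN => h.
rewrite distrC; apply: le_trans (le_trans (ler_norm _) h).
by apply: le_trans ue; rewrite /norm1 !raddfB /= lerDr.
Qed.

(* The sum equals [e_N(s)^2 - e_N(2s)], where [e_N] is the N-th partial sum of exp:
   only the terms above the diagonal of the product of two partial sums are left. *)
Lemma exp_tail_cvg0 (s : R) :
  (fun N => \sum_(k < N) \sum_(l < N | (N - k <= l)%N)
     (s ^+ k / k`!%:R) * (s ^+ l / l`!%:R)) @ \oo --> 0.
Proof.
pose e x N : R := \sum_(k < N) x ^+ k / k`!%:R.
have e_cvg x : e x @ \oo --> expR x.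
  have -> : e x = series (exp_coeff x).
    by apply/funext => N; rewrite /e /series /= big_mkord.
  exact: is_cvg_series_exp_coeff.
have -> : (fun N => \sum_(k < N) \sum_(l < N | (N - k <= l)%N)
     (s ^+ k / k`!%:R) * (s ^+ l / l`!%:R)) = (fun N => e s N * e s N - e (s + s) N).
  apply/funext => N; apply/eqP; rewrite eq_sym subr_eq; apply/eqP.
  (* The pairs with [k + l < N] are grouped by antidiagonal; the binomial theorem sums antidiagonal
     [m] to [(s + s) ^+ m / m!]. *)
  have -> : e (s + s) N = \sum_(k < N) \sum_(l < N - k) s ^+ k / k`!%:R * (s ^+ l / l`!%:R).
    rewrite (sum_triangle (fun k l => s ^+ k / k`!%:R * (s ^+ l / l`!%:R))).
    apply: eq_bigr => m _; rewrite exprDn mulr_suml; apply: eq_bigr => k _.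
    have km : (k <= m)%N by rewrite -ltnS.
    rewrite -mulr_natr -(bin_fact km) !natrM.
    field.
    by rewrite !pnatr_eq0 -!lt0n !fact_gt0 bin_gt0.
  rewrite /e mulr_suml -big_split /=; apply: eq_bigr => k _.
  rewrite mulr_sumr (bigID (fun l : 'I_N => (N - k <= l)%N)) /=; congr (_ + _).
  rewrite (big_ord_widen_cond _ xpredT (fun l => s ^+ k / k`!%:R * (s ^+ l / l`!%:R)) (leq_subr k N)).
  by apply: eq_bigl => l; rewrite ltnNge.
have -> : 0 = expR s * expR s - expR (s + s) by rewrite expRD subrr.
by apply: cvgB; [apply: cvgM|]; exact: e_cvg.
Qed.
End CauchySum.

(** * The matrix exponential and its inverse *)

Section MatrixExponential.
Variables (R : realType) (d : nat) (M : 'M[R[i]]_d).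

Definition exp_sum (t : R) (N : nat) : 'M[R[i]]_d :=
  \sum_(k < N) (t ^+ k / k`!%:R)%:C *: (M ^+ k).

(** The sum of [norm1] over all entries of [M] serves as [c]: it dominates every row sum, which is
    what the induction on [k] needs. *)
Lemma norm1_mxX_le : exists c : R, 0 <= c /\ forall k i j, norm1 ((M ^+ k) i j) <= c ^+ k.
Proof.
exists (\sum_i \sum_j norm1 (M i j)).
have c0 : 0 <= \sum_i \sum_j norm1 (M i j).
  by do 2 (apply: sumr_ge0 => ? _); exact: norm1_ge0.
split=> //; elim=> [|k ih] i j.
  rewrite !expr0 [1]/(1%:M : 'M[R[i]]_d) mxE /norm1.
  by case: (i == j); rewrite /= ?normr1 ?normr0 addr0.
rewrite exprS mxE; apply: le_trans (norm1_sum _ _) _.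
rewrite exprS [X in _ <= X * _](bigD1 i) //= mulrDl; apply: ler_wpDr.
  apply: mulr_ge0; last exact: exprn_ge0.
  by do 2 (apply: sumr_ge0 => ? _); exact: norm1_ge0.
rewrite mulr_suml; apply: ler_sum => l _.
apply: le_trans (norm1M _ _) _; apply: ler_wpM2l (ih _ _); exact: norm1_ge0.
Qed.

(** Each entry is a series dominated by the real exponential series at [|t| * c]. *)
Lemma exp_sum_mcvg (t : R) : exists E, mcvg \oo (exp_sum t) E.
Proof.
have [c [c0 Mc]] := norm1_mxX_le.
(* Real and imaginary parts are handled at once, as real-homogeneous functionals bounded by
   [norm1]. *)
have cvg_part (f : {additive R[i] -> R}) i j :
    (forall (x : R) z, f (x%:C * z) = x * f z) -> (forall z, `|f z| <= norm1 z) ->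
    cvgn (fun N => f (exp_sum t N i j)).
  move=> fZ f_le.
  pose u k := t ^+ k / k`!%:R * f ((M ^+ k) i j).
  have -> : (fun N => f (exp_sum t N i j)) = series u.
    apply/funext => N; rewrite /series /= big_mkord /exp_sum summxE raddf_sum.
    by apply: eq_bigr => k _; rewrite mxE fZ.
  apply: normed_cvg; apply: (@series_le_cvg _ _ (exp_coeff (`|t| * c))).
  - by move=> k; exact: normr_ge0.
  - by move=> k; apply: exp_coeff_ge0; rewrite mulr_ge0.
  - move=> k; rewrite /exp_coeff /= /u !normrM normfV normrX exprMn [`|k`!%:R|]ger0_norm //.
    rewrite mulrAC ler_wpM2r ?invr_ge0 // ler_wpM2l ?exprn_ge0 //.
    exact: le_trans (f_le _) (Mc _ _ _).
  - exact: is_cvg_series_exp_coeff.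
have ReZ (x : R) (z : R[i]) : complex.Re (x%:C * z) = x * complex.Re z.
  by case: z => a b /=; rewrite mul0r subr0.
have ImZ (x : R) (z : R[i]) : complex.Im (x%:C * z) = x * complex.Im z.
  by case: z => a b /=; rewrite mul0r addr0.
exists (\matrix_(i, j) (limn (fun N => complex.Re (exp_sum t N i j))
  +i* limn (fun N => complex.Im (exp_sum t N i j)))) => i j.
rewrite mxE; split.
  by apply: (cvg_part (@complex.Re R)) => // z; rewrite /norm1 lerDl.
by apply: (cvg_part (@complex.Im R)) => // z; rewrite /norm1 lerDr.
Qed.

(** The product of the two partial sums splits along [k + l < N]. Below this line the terms add up
    to the identity exactly; the remaining ones are dominated by the tail of [exp_tail_cvg0] at
    [s = |t| * c]. *)
Lemma exp_sum_opp_mcvg1 (t : R) :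
  mcvg \oo (fun N => exp_sum (- t) N *m exp_sum t N) 1%:M.
Proof.
have [c [c0 Mc]] := norm1_mxX_le => i j.
pose f k l := ((- t) ^+ k / k`!%:R * (t ^+ l / l`!%:R))%:C *: M ^+ (k + l).
have prodE N : exp_sum (- t) N *m exp_sum t N = \sum_(k < N) \sum_(l < N) f k l.
  rewrite /exp_sum mulmx_suml; apply: eq_bigr => k _.
  rewrite mulmx_sumr; apply: eq_bigr => l _.
  by rewrite -scalemxAl -scalemxAr scalerA /f exprD -(rmorphM (real_complex R)).
have diagE N : \sum_(k < N.+1) \sum_(l < N.+1 | ~~ (N.+1 - k <= l)%N) f k l = 1.
  transitivity (\sum_(k < N.+1) \sum_(l < N.+1 - k) f k l).
    apply: eq_bigr => k _.
    rewrite (big_ord_widen_cond _ xpredT (f k) (leq_subr k N.+1)).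
    by apply: eq_bigl => l; rewrite ltnNge.
  (* Antidiagonal 0 contributes the identity; antidiagonal [m > 0] contributes a multiple of
     [(- t + t) ^+ m], which is 0. *)
  rewrite sum_triangle big_ord_recl big_ord1 /f /= !expr0 fact0 divr1 mulr1 scale1r.
  rewrite big1 ?addr0 // => m _.
  transitivity ((((- t) + t) ^+ (bump 0 m) / (bump 0 m)`!%:R)%:C *: M ^+ (bump 0 m)).
    rewrite addrC exprDn mulr_suml (rmorph_sum (real_complex R)) scaler_suml.
    apply: eq_bigr => k _; rewrite subnKC; last by rewrite -ltnS.
    have km : (k <= bump 0 m)%N by rewrite -ltnS.
    congr (_%:C *: _); rewrite -mulr_natr -(bin_fact km) !natrM.
    by field; rewrite !pnatr_eq0 -!lt0n !fact_gt0 bin_gt0.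
  by rewrite addNr expr0n /= mul0r scale0r.
apply: (ccvg_norm1_le (e := fun N => \sum_(k < N) \sum_(l < N | (N - k <= l)%N)
  ((`|t| * c) ^+ k / k`!%:R) * ((`|t| * c) ^+ l / l`!%:R))); last exact: exp_tail_cvg0.
(* For [N = 0] the product is empty and differs from the identity, so the bound is claimed from
   [N = 1] on. *)
exists 1 => // -[|N] // _.
have -> : (exp_sum (- t) N.+1 *m exp_sum t N.+1) i j - 1%:M i j =
    \sum_(k < N.+1) \sum_(l < N.+1 | (N.+1 - k <= l)%N) f k l i j.
  rewrite prodE; under eq_bigr => k _.
    rewrite (bigID (fun l : 'I_N.+1 => (N.+1 - k <= l)%N)) /=; over.
  rewrite big_split /= diagE mxE addrK summxE; apply: eq_bigr => k _.
  by rewrite summxE.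
apply: le_trans (norm1_sum _ _) _; apply: ler_sum => k _.
apply: le_trans (norm1_sum _ _) _; apply: ler_sum => l _.
rewrite /f mxE norm1R !normrM !normfV !normrX normrN !exprMn.
rewrite [`|k`!%:R|]ger0_norm // [`|l`!%:R|]ger0_norm //.
rewrite [leRHS](_ : _ = (`|t| ^+ k / k`!%:R * (`|t| ^+ l / l`!%:R)) * c ^+ (k + l)).
  by rewrite ler_wpM2l // !mulr_ge0 // ?invr_ge0 ?exprn_ge0.
by rewrite exprD; ring.
Qed.

Definition exp_mx (t : R) : 'M[R[i]]_d := projT1 (cid (exp_sum_mcvg t)).

Lemma exp_mx_mcvg t : mcvg \oo (exp_sum t) (exp_mx t).
Proof. by rewrite /exp_mx; case: cid. Qed.

Lemma exp_mxNM t : exp_mx (- t) *m exp_mx t = 1%:M.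
Proof.
by apply: mcvg_unique (exp_sum_opp_mcvg1 t); apply: mcvgM; exact: exp_mx_mcvg.
Qed.

End MatrixExponential.

(** * The flow as a matrix exponential, and what it preserves *)

Section Flow.
Variables (R : realType) (n : nat) (L : {linear 'M[R[i]]_n -> 'M[R[i]]_n}).
Local Notation mx := 'M[R[i]]_n.

Lemma mxvec_iter k (rho : mx) : mxvec (iter k L rho) = mxvec rho *m lin_mx L ^+ k.
Proof.
elim: k => [|k ih]; first by rewrite expr0 mulmx1.
by rewrite iterS -mul_vec_lin ih exprSr mulmxA.
Qed.

(** Vectorizing matrices turns [L] into right multiplication by [lin_mx L], so its exponential
    series is that of a matrix applied to a fixed row vector. *)
Lemma flow_cvg_aux t (rho : mx) :
  mcvg \oo (fun N => \sum_(k < N) (t ^+ k / k`!%:R)%:C *: iter k L rho)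
       (vec_mx (mxvec rho *m exp_mx (lin_mx L) t)).
Proof.
move=> i j; rewrite mxE.
have -> : (fun N => (\sum_(k < N) (t ^+ k / k`!%:R)%:C *: iter k L rho) i j) =
    (fun N => (mxvec rho *m exp_sum (lin_mx L) t N) 0 (mxvec_index i j)).
  apply/funext => N; rewrite -mxvecE linear_sum /= mulmx_sumr; congr (fun_of_matrix _ _ _).
  by apply: eq_bigr => k _; rewrite linearZ /= mxvec_iter scalemxAr.
by apply: mcvgM; [exact: mcvg_cst|exact: exp_mx_mcvg].
Qed.

Lemma flowE t (rho : mx) : flow L t rho = vec_mx (mxvec rho *m exp_mx (lin_mx L) t).
Proof.
apply/matrixP => i j; rewrite /flow mxE.
have [hRe hIm] := flow_cvg_aux t rho i j.
rewrite (cvg_lim (@Rhausdorff R) hRe) (cvg_lim (@Rhausdorff R) hIm).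
by case: (vec_mx _ i j).
Qed.

Lemma flow_cvg t (rho : mx) :
  mcvg \oo (fun N => \sum_(k < N) (t ^+ k / k`!%:R)%:C *: iter k L rho) (flow L t rho).
Proof. by rewrite flowE; exact: flow_cvg_aux. Qed.

Lemma flow_linear t : linear (flow L t).
Proof. by move=> z u v; rewrite !flowE linearP mulmxDl -scalemxAl linearP. Qed.

HB.instance Definition _ t := GRing.isLinear.Build _ _ _ _ (flow L t) (flow_linear t).

Lemma flowKN t : cancel (flow L (- t)) (flow L t).
Proof.
move=> v; rewrite !flowE vec_mxK -mulmxA.
by rewrite exp_mxNM mulmx1 mxvecK.
Qed.

Lemma flow_trace t (L_tr : forall v, \tr (L v) = 0) v : \tr (flow L t v) = \tr v.
Proof.
apply: (ccvg_unique (mcvg_trace (flow_cvg t v))) => /=.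
(* Every term with [k > 0] is in the image of [L] and has trace 0. The term [k = 0] is [v], present
   only from [N = 1] on. *)
have E : \forall N \near \oo, \tr v = 
    \tr (\sum_(k < N) (t ^+ k / k`!%:R)%:C *: iter k L v).
  exists 1 => // -[//|N] _; rewrite big_ord_recl /= raddfD /= raddf_sum /= big1.
    by rewrite expr0 fact0 divr1 scale1r addr0.
  by move=> k _; rewrite linearZ /= L_tr mulr0.
by split; apply: cvg_near_cst; apply: filterS E => N <-.
Qed.

(** The series has real coefficients, so each partial sum commutes with the adjoint, and the limit
    does too. *)
Lemma flow_adj t (L_adj : forall v, L (v ^t*) = (L v) ^t*) v :
  flow L t (v ^t*) = (flow L t v) ^t*.
Proof.
apply: (mcvg_unique (flow_cvg t (v ^t*))).
have -> : (fun N => \sum_(k < N) (t ^+ k / k`!%:R)%:C *: iter k L (v ^t*)) =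
    (fun N => (\sum_(k < N) (t ^+ k / k`!%:R)%:C *: iter k L v) ^t*).
  apply/funext => N; rewrite (big_morph (fun u : mx => u ^t*) (@adjD R n) (_ : 0 ^t* = 0)).
    apply: eq_bigr => k _; rewrite Defs.adjZ conj_real; congr (_ *: _).
    by elim: (k : nat) => //= m ->; rewrite L_adj.
  exact/hermP/herm0.
exact: mcvg_adj (flow_cvg t v).
Qed.

End Flow.

(** * Duals of linear maps for the trace pairing *)

Section TraceAdjoint.
Variables (R : realType) (n : nat).
Local Notation mx := 'M[R[i]]_n.
Implicit Types (a b v : mx) (F : {linear mx -> mx}).

Lemma trace_delta j k a : \tr (delta_mx j k *m a) = a k j.
Proof.
rewrite mxtrace_mulC /mxtrace (bigD1 k) //= big1 ?addr0 => [|l lk].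
  rewrite mxE (bigD1 j) //= big1 ?addr0 => [|m mj]; first by rewrite mxE !eqxx mulr1.
  by rewrite mxE (negPf mj) mulr0.
by rewrite mxE big1 // => m _; rewrite mxE (negPf lk) andbF mulr0.
Qed.

Lemma trace_inj a b : (forall v, \tr (v *m a) = \tr (v *m b)) -> a = b.
Proof. by move=> h; apply/matrixP => i j; rewrite -!trace_delta h. Qed.

(** The transpose of [F] for the complex-bilinear pairing [\tr (u *m v)]. By [trace_delta], pairing
    with matrix units reads off entries, which forces this formula. *)
Definition trace_adjoint (F : mx -> mx) a : mx :=
  \matrix_(k, j) \tr (F (delta_mx j k) *m a).

Lemma trace_adjointE F a v : \tr (v *m trace_adjoint F a) = \tr (F v *m a).
Proof.
rewrite {2}(matrix_sum_delta v) linear_sum mulmx_suml linear_sum /=.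
apply: eq_bigr => j _.
rewrite linear_sum mulmx_suml linear_sum mxE /=; apply: eq_bigr => k _.
by rewrite mxE linearZ -scalemxAl linearZ.
Qed.

Lemma trace_adjoint_linear F : linear (trace_adjoint F).
Proof.
by move=> z a b; apply/matrixP => i j; rewrite !mxE mulmxDr -scalemxAr linearP.
Qed.

HB.instance Definition _ F :=
  GRing.isLinear.Build _ _ _ _ (trace_adjoint F) (trace_adjoint_linear F).

Lemma trace_adj a : \tr (a ^t*) = Num.conj (\tr a).
Proof. by rewrite /mxtrace rmorph_sum; apply: eq_bigr => i _; rewrite !mxE. Qed.

Lemma adj_mulmx a b : (a *m b) ^t* = b ^t* *m a ^t*.
Proof. by rewrite trmx_mul map_mxM. Qed.

Lemma trace_adjoint_adj F (F_adj : forall v, F (v ^t*) = (F v) ^t*) a :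
  trace_adjoint F (a ^t*) = (trace_adjoint F a) ^t*.
Proof.
apply: trace_inj => v; rewrite trace_adjointE.
rewrite -[in LHS](trmxCK v) F_adj -adj_mulmx trace_adj mxtrace_mulC -trace_adjointE.
by rewrite mxtrace_mulC -trace_adj adj_mulmx trmxCK mxtrace_mulC.
Qed.

End TraceAdjoint.

(** * Hermitian matrices and density matrices span all matrices *)

Section Spanning.
Variables (R : realType) (n : nat).
Local Notation mx := 'M[R[i]]_n.
Lemma conj_i : Num.conj ('i : R[i]) = - 'i.
Proof. by congr (_ +i* _); rewrite /= oppr0. Qed.

Lemma half_real : (2^-1)%:C = 2^-1 :> R[i].
Proof. by rewrite (fmorphV (real_complex R)) rmorphD. Qed.

Variable P : mx -> Prop.
Hypothesis P_linear : forall z u v, P u -> P v -> P (z *: u + v).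

Lemma herm_ind : (forall a, a \is hermsymmx -> P a) -> forall a, P a.
Proof.
move=> Ph a.
have -> : a = (- ('i / 2)) *: ('i *: (a - a ^t*)) + (2^-1)%:C *: (a + a ^t*).
  have i2 : 'i * 'i = -1 :> R[i] by rewrite -expr2 sqr_i.
  apply/matrixP => i j; rewrite half_real !mxE.
  move: (a i j) (Num.conj (a j i)) => x y.
  by rewrite mulrA mulNr mulrAC i2; field.
apply: P_linear; apply: Ph; apply/hermP; rewrite Defs.adjZ.
  by rewrite conj_i linearB /= map_mxB trmxCK scaleNr -scalerN opprB.
by rewrite conj_real adjD trmxCK addrC.
Qed.

(** A matrix is a combination of matrix units, these are outer products of vectors, and a nonzero
    [x *m x ^t*] is a positive multiple of a density. [P 0] is a separate premise: for [n = 0] there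
    is no density to derive it from. *)
Lemma density_ind : P 0 -> (forall rho, is_density rho -> P rho) -> forall v, P v.
Proof.
move=> P0 Pd.
have Pvec (x : 'cV[R[i]]_n) : P (x *m x ^t*).
  have s_ge0 : 0 <= \tr (x *m x ^t*).
    by apply: sumr_ge0 => i _; rewrite mxE big_ord1 !mxE -normCK exprn_ge0.
  (* The trace is the sum of the squared moduli of the coordinates of [x]: it vanishes only for
     [x = 0], and otherwise dividing by it gives a density. *)
  have [s0|s_neq0] := eqVneq (\tr (x *m x ^t*)) 0.
    suff -> : x = 0 by rewrite mul0mx.
    apply/matrixP => i j; rewrite ord1 mxE; apply/eqP.
    rewrite -normr_eq0 -sqrf_eq0 normCK.
    move/psumr_eq0P: s0 => /(_ _ i isT); rewrite mxE big_ord1 !mxE => -> //.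
    by move=> k _; rewrite mxE big_ord1 !mxE -normCK exprn_ge0.
  rewrite -[_ *m _]addr0 -[X in P (X + _)](scalerKV s_neq0).
  apply: P_linear => //; apply: Pd; split.
  - apply/hermP; rewrite Defs.adjZ trmx_mul map_mxM trmxCK.
    by congr (_ *: _); rewrite fmorphV; congr (_^-1); apply/CrealP; exact: ger0_real.
  - move=> v; rewrite -scalemxAr -scalemxAl mxE mulr_ge0 ?invr_ge0 //.
    rewrite (mulmxA (v ^t*)) -(mulmxA (v ^t* *m x)) mxE big_ord1.
    have -> : v ^t* *m x = (x ^t* *m v) ^t* by rewrite trmx_mul map_mxM trmxCK.
    by rewrite !mxE mulrC -normCK exprn_ge0.
  - by rewrite linearZ /= mulVf.
(* Polarization: outer products are combinations of the positive ones of [Pvec]. *)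
have Pouter (x y : 'cV[R[i]]_n) : P (x *m y ^t*).
  have -> : x *m y ^t* = (1 / 4) *: ((x + y) *m (x + y) ^t*)
      + ((- (1 / 4)) *: ((x - y) *m (x - y) ^t*)
      + (('i / 4) *: ((x + 'i *: y) *m (x + 'i *: y) ^t*)
      + ((- ('i / 4)) *: ((x - 'i *: y) *m (x - 'i *: y) ^t*) + 0))).
    have i2 : 'i * 'i = -1 :> R[i] by rewrite -expr2 sqr_i.
    apply/matrixP => i j; rewrite !(mxE, big_ord1).
    rewrite !(rmorphD, rmorphN, rmorphM) /= conj_i.
    move: (x i 0) (y i 0) (Num.conj (x j 0)) (Num.conj (y j 0)) => p q p' q'.
    by field: i2.
  by do 4 (apply: P_linear; first exact: Pvec).
move=> v; rewrite (matrix_sum_delta v).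
have PD u w : P u -> P w -> P (u + w).
  by move=> *; rewrite -[u]scale1r; exact: P_linear.
apply: big_ind => // i _; apply: big_ind => // j _.
rewrite -[_ *: _]addr0; apply: P_linear => //.
have -> : delta_mx i j = delta_mx i 0 *m (delta_mx j (0 : 'I_1)) ^t* :> mx.
  by rewrite trmx_delta map_delta_mx mul_delta_mx.
exact: Pouter.
Qed.

End Spanning.

(** * Antisymmetric and symmetric parts of a product compatible with the adjoint *)

Section Symmetrization.
Variables (R : realType) (n : nat).
Local Notation mx := 'M[R[i]]_n.
Implicit Types (a b c xi : mx) (S : mx -> mx -> mx).

Definition lie_of S a b : mx := (- ('i / 2)) *: (S a b - S b a).

Definition jordan_of S a b : mx := (1 / 2) *: (S a b + S b a).

(** The two parts determine the product, so controlling both brackets in the limit controls [S]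
    itself. *)
Lemma jordan_lie_of S a b : jordan_of S a b + 'i *: lie_of S a b = S a b.
Proof.
have i2 : 'i * 'i = -1 :> R[i] by rewrite -expr2 sqr_i.
rewrite /jordan_of /lie_of scalerA mulrN mulrA i2; apply/matrixP => i j.
by rewrite !mxE; field.
Qed.

Lemma trace_expect a xi : a \is hermsymmx -> xi \is hermsymmx ->
  \tr (xi *m a) = (expect a xi)%:C.
Proof.
move=> /hermP ha /hermP hxi.
have : Num.conj (\tr (xi *m a)) = \tr (xi *m a).
  by rewrite -trace_adj adj_mulmx ha hxi mxtrace_mulC.
rewrite /expect; case: (\tr _) => x y [] /= hy; congr (_ +i* _); lra.
Qed.

Lemma conj_i_half : Num.conj (- ('i / 2) : R[i]) = 'i / 2.
Proof. by rewrite -half_real !rmorphN /= rmorphM /= conj_i conj_real mulNr opprK. Qed.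

Section Adjoint.
Variable S : mx -> mx -> mx.
Hypothesis S_adj : forall a b, (S a b) ^t* = S (b ^t*) (a ^t*).

(** The adjoint reverses the product and so negates the commutator; conjugation negates ['i / 2],
    and the signs cancel. *)
Lemma lie_of_herm a b : a \is hermsymmx -> b \is hermsymmx ->
  lie_of S a b \is hermsymmx.
Proof.
move=> /hermP ha /hermP hb; apply/hermP.
rewrite /lie_of Defs.adjZ linearB /= map_mxB !S_adj ha hb.
by rewrite -opprB scalerN -scaleNr conj_i_half.
Qed.

Lemma jordan_of_herm a b : a \is hermsymmx -> b \is hermsymmx ->
  jordan_of S a b \is hermsymmx.
Proof.
move=> /hermP ha /hermP hb; apply/hermP.
by rewrite /jordan_of Defs.adjZ adjD !S_adj ha hb addrC mul1r -half_real conj_real.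
Qed.

Lemma trace_product a b xi : a \is hermsymmx -> b \is hermsymmx ->
    xi \is hermsymmx ->
  \tr (xi *m S a b) =
    (expect (jordan_of S a b) xi)%:C + 'i * (expect (lie_of S a b) xi)%:C.
Proof.
move=> ha hb hxi; have <- := jordan_lie_of S a b.
move: (jordan_of_herm ha hb) (lie_of_herm ha hb).
move: (jordan_of S a b) (lie_of S a b) => u v hu hv.
have <- := trace_expect hu hxi; have <- := trace_expect hv hxi.
by rewrite mulmxDr mxtraceD -scalemxAr mxtraceZ.
Qed.

End Adjoint.
End Symmetrization.

(** * The transported products and their limit as time tends to infinity *)

Section Heisenberg.
Variables (R : realType) (n : nat) (L : {linear 'M[R[i]]_n -> 'M[R[i]]_n}).
Local Notation mx := 'M[R[i]]_n.
Implicit Types (a b c xi v : mx) (t : R).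

Definition heisenberg t : mx -> mx := trace_adjoint (flow L t).

Lemma heisenbergE t a v : \tr (v *m heisenberg t a) = \tr (flow L t v *m a).
Proof. exact: trace_adjointE. Qed.

Lemma heisenberg_linear t : linear (heisenberg t).
Proof. exact: trace_adjoint_linear. Qed.

HB.instance Definition _ t :=
  GRing.isLinear.Build _ _ _ _ (heisenberg t) (heisenberg_linear t).

(** Duality reverses composition, so this is the dual of [flowKN]. *)
Lemma heisenbergK t : cancel (heisenberg t) (heisenberg (- t)).
Proof. by move=> a; apply: trace_inj => v; rewrite !heisenbergE flowKN. Qed.

Lemma heisenbergKN t : cancel (heisenberg (- t)) (heisenberg t).
Proof. by move=> a; rewrite -{1}[t]opprK heisenbergK. Qed.

Lemma d_expect_flow t a : d_expect a \o flow L t = d_expect (heisenberg t a).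
Proof. by apply/funext => v; rewrite /d_expect /expect heisenbergE. Qed.

Definition star t a b : mx := heisenberg (- t) (heisenberg t a *m heisenberg t b).

Lemma starA t : associative (star t).
Proof. by move=> a b c; rewrite /star !heisenbergKN mulmxA. Qed.

Lemma star_linearl t b : linear (star t ^~ b).
Proof. by move=> z u v; rewrite /star linearP mulmxDl -scalemxAl linearP. Qed.

Lemma star_linearr t a : linear (star t a).
Proof. by move=> z u v; rewrite /star linearP mulmxDr -scalemxAr linearP. Qed.

Lemma heisenberg_lie t a b :
  heisenberg (- t) (lie_mx (heisenberg t a) (heisenberg t b)) = lie_of (star t) a b.
Proof. by rewrite /lie_mx linearZ linearB. Qed.

Lemma heisenberg_jordan t a b :
  heisenberg (- t) (jordan_mx (heisenberg t a) (heisenberg t b))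
    = jordan_of (star t) a b.
Proof. by rewrite /jordan_mx linearZ linearD. Qed.

Lemma expect_flow t a xi : expect a (flow L t xi) = expect (heisenberg t a) xi.
Proof. by rewrite /expect heisenbergE. Qed.

Hypothesis L_tr : forall v, \tr (L v) = 0.
Hypothesis L_adj : forall v, L (v ^t*) = (L v) ^t*.

Lemma heisenberg_adj t a : heisenberg t (a ^t*) = (heisenberg t a) ^t*.
Proof. by apply: trace_adjoint_adj => v; exact: flow_adj. Qed.

Lemma heisenberg_herm t a : a \is hermsymmx -> heisenberg t a \is hermsymmx.
Proof. by move=> /hermP ha; apply/hermP; rewrite -heisenberg_adj ha. Qed.

Lemma star_adj t a b : (star t a b) ^t* = star t (b ^t*) (a ^t*).
Proof. by rewrite /star -heisenberg_adj adj_mulmx -!heisenberg_adj. Qed.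

(** Push-forward evaluates a tensor at the point moved backwards in time, where positivity may be
    lost; Hermiticity and unit trace survive, and they suffice for the tensor formulas. *)
Lemma flow_hyperplane t xi : hyperplane xi -> hyperplane (flow L t xi).
Proof.
case=> /hermP hxi tr1; split; last by rewrite flow_trace.
by apply/hermP; rewrite -[LHS](flow_adj t L_adj xi) hxi.
Qed.

Lemma d_expect_covector a : is_covector (d_expect a).
Proof.
move=> c u v _ _; rewrite /d_expect /expect mulmxDl -scalemxAl linearP /=.
by case: (\tr (u *m a)) (\tr (v *m a)) => x y [x' y'] /=; rewrite mul0r subr0.
Qed.

Lemma Lambda_push t a b xi : a \is hermsymmx -> b \is hermsymmx -> hyperplane xi ->
  flow_pushforward L (@Lambda_D R n) t xi (d_expect a) (d_expect b)
    = expect (lie_of (star t) a b) xi.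
Proof.
move=> ha hb hxi; rewrite /flow_pushforward /Defs.pushforward !d_expect_flow.
rewrite (Lambda_DE (heisenberg_herm t ha) (heisenberg_herm t hb) (flow_hyperplane (- t) hxi)).
by rewrite expect_flow heisenberg_lie.
Qed.

(** The term [expect a xi * expect b xi] does not depend on time: evolving the observable forwards
    and the point backwards cancels by [heisenbergK]. *)
Lemma R_push t a b xi : a \is hermsymmx -> b \is hermsymmx -> hyperplane xi ->
  flow_pushforward L (@R_D R n) t xi (d_expect a) (d_expect b)
    = expect (jordan_of (star t) a b) xi - expect a xi * expect b xi.
Proof.
move=> ha hb hxi; rewrite /flow_pushforward /Defs.pushforward !d_expect_flow.
rewrite (R_DE (heisenberg_herm t ha) (heisenberg_herm t hb) (flow_hyperplane (- t) hxi)).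
by rewrite !expect_flow heisenberg_jordan !heisenbergK.
Qed.

Variables Lambda_inf R_inf : tensor20 R n.
Hypothesis Lambda_cvg :
  tensor_cvg (flow_pushforward L (@Lambda_D R n)) Lambda_inf.
Hypothesis R_cvg : tensor_cvg (flow_pushforward L (@R_D R n)) R_inf.

Lemma density_hyperplane (rho : mx) : is_density rho -> hyperplane rho.
Proof. by case. Qed.

Lemma lie_star_cvg a b rho : a \is hermsymmx -> b \is hermsymmx -> is_density rho ->
  expect (lie_of (star t) a b) rho @[t --> +oo]
    --> Lambda_inf rho (d_expect a) (d_expect b).
Proof.
move=> ha hb hr.
have -> : (fun t => expect (lie_of (star t) a b) rho) =
    (fun t => flow_pushforward L (@Lambda_D R n) t rho (d_expect a) (d_expect b)).
  by apply/funext => t; rewrite (Lambda_push t ha hb (density_hyperplane hr)).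
exact: Lambda_cvg hr _ _ (d_expect_covector a) (d_expect_covector b).
Qed.

Lemma jordan_star_cvg a b rho : a \is hermsymmx -> b \is hermsymmx -> is_density rho ->
  expect (jordan_of (star t) a b) rho @[t --> +oo]
    --> R_inf rho (d_expect a) (d_expect b) + expect a rho * expect b rho.
Proof.
move=> ha hb hr.
have -> : (fun t => expect (jordan_of (star t) a b) rho) =
    (fun t => flow_pushforward L (@R_D R n) t rho (d_expect a) (d_expect b)
              + expect a rho * expect b rho).
  by apply/funext => t; rewrite (R_push t ha hb (density_hyperplane hr)) subrK.
apply: cvgD; last exact: cvg_cst.
exact: R_cvg hr _ _ (d_expect_covector a) (d_expect_covector b).
Qed.

(** Entries are traces against matrix units. Linearity in the test matrix and in both factors
    reduces these traces to a density and Hermitian [a], [b], where [trace_product] expresses them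
    by the two convergent brackets. *)
Lemma star_is_cvg a b : exists s, mcvg +oo (fun t => star t a b) s.
Proof.
suff h v : exists l, ccvg +oo (fun t => \tr (v *m star t a b)) l.
  exists (\matrix_(i, j) projT1 (cid (h (delta_mx j i)))) => i j.
  rewrite mxE; case: cid => l /=.
  by under eq_fun do rewrite trace_delta.
have lin (f g : R -> R[i]) z : (exists l, ccvg +oo f l) -> (exists l, ccvg +oo g l) ->
    exists l, ccvg +oo (fun t => z * f t + g t) l.
  by move=> [l fl] [m gm]; exists (z * l + m); apply: ccvgD => //; exact: ccvgZ.
move: v; apply: density_ind => [z u w hu hw||rho hr].
- have E : (fun t => \tr ((z *: u + w) *m star t a b)) =
      (fun t => z * \tr (u *m star t a b) + \tr (w *m star t a b)).
    by apply/funext => t; rewrite mulmxDl -scalemxAl mxtraceD mxtraceZ.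
  by rewrite E; exact: lin.
- exists 0; have -> : (fun t => \tr (0 *m star t a b)) = (fun=> 0).
    by apply/funext => t; rewrite mul0mx mxtrace0.
  exact: ccvg_cst.
move: b; apply: herm_ind => [z u w hu hw|b hb].
  have E : (fun t => \tr (rho *m star t a (z *: u + w))) =
      (fun t => z * \tr (rho *m star t a u) + \tr (rho *m star t a w)).
    by apply/funext => t; rewrite star_linearr mulmxDr -scalemxAr mxtraceD mxtraceZ.
  by rewrite E; exact: lin.
move: a; apply: herm_ind => [z u w hu hw|a ha].
  have E : (fun t => \tr (rho *m star t (z *: u + w) b)) =
      (fun t => z * \tr (rho *m star t u b) + \tr (rho *m star t w b)).
    by apply/funext => t; rewrite star_linearl mulmxDr -scalemxAr mxtraceD mxtraceZ.
  by rewrite E; exact: lin.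
exists ((R_inf rho (d_expect a) (d_expect b) + expect a rho * expect b rho)%:C
        + 'i * (Lambda_inf rho (d_expect a) (d_expect b))%:C).
have -> : (fun t => \tr (rho *m star t a b)) = (fun t =>
    (expect (jordan_of (star t) a b) rho)%:C + 'i * (expect (lie_of (star t) a b) rho)%:C).
  by apply/funext => t; apply: (trace_product (star_adj t) ha hb); case: hr.
apply: ccvgD; last apply: ccvgZ; split => /=; try exact: cvg_cst.
  exact: jordan_star_cvg.
exact: lie_star_cvg.
Qed.

Definition star_inf a b : mx := projT1 (cid (star_is_cvg a b)).

Lemma star_infP a b : mcvg +oo (fun t => star t a b) (star_inf a b).
Proof. by rewrite /star_inf; case: cid. Qed.

Lemma star_inf_linearr a : linear (star_inf a).
Proof.
move=> z u v; apply: mcvg_unique (star_infP a _) _.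
have -> : (fun t => star t a (z *: u + v)) = (fun t => z *: star t a u + star t a v).
  by apply/funext => t; exact: star_linearr.
by apply: mcvgD (star_infP a v); apply: mcvgZ (star_infP a u); exact: ccvg_cst.
Qed.

Lemma star_inf_linearl b : linear (star_inf ^~ b).
Proof.
move=> z u v; apply: mcvg_unique (star_infP _ b) _.
have -> : (fun t => star t (z *: u + v) b) = (fun t => z *: star t u b + star t v b).
  by apply/funext => t; exact: star_linearl.
by apply: mcvgD (star_infP v b); apply: mcvgZ (star_infP u b); exact: ccvg_cst.
Qed.

Lemma star_inf_adj a b : (star_inf a b) ^t* = star_inf (b ^t*) (a ^t*).
Proof.
apply: mcvg_unique (mcvg_adj (star_infP a b)) _.
have -> : (fun t => (star t a b) ^t*) = (fun t => star t (b ^t*) (a ^t*)).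
  by apply/funext => t; exact: star_adj.
exact: star_infP.
Qed.

(** In [star t a (star t b c)] both the map and its argument vary with [t]; [lin_cvg] justifies
    taking the two limits together. *)
Lemma star_infA : associative star_inf.
Proof.
have lin_cvg (f : R -> mx -> mx) (g : mx -> mx) (u : R -> mx) v :
    (forall t, linear (f t)) -> linear g ->
    (forall w, mcvg +oo (f ^~ w) (g w)) -> mcvg +oo u v ->
    mcvg +oo (fun t => f t (u t)) (g v).
  move=> f_lin g_lin fg uv.
  (* In finite dimension a linear map is determined by finitely many values, so pointwise
     convergence of the maps is enough. *)
  have expand (h : mx -> mx) w : linear h ->
      h w = \sum_i \sum_j w i j *: h (delta_mx i j).
    move=> h_lin; pose hL := GRing.isLinear.Build _ _ _ _ h h_lin.
    pose h' : {linear mx -> mx} := HB.pack h hL.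
    rewrite -[h]/(h' : mx -> mx) {1}(matrix_sum_delta w) linear_sum.
    apply: eq_bigr => i _; rewrite linear_sum; apply: eq_bigr => j _.
    by rewrite linearZ.
  have -> : (fun t => f t (u t)) =
      (fun t => \sum_i \sum_j u t i j *: f t (delta_mx i j)).
    by apply/funext => t; exact: expand.
  rewrite (expand _ _ g_lin).
  by do 2 (apply: mcvg_sum => ?); apply: mcvgZ.
move=> a b c.
have h1 := lin_cvg _ _ _ _ (star_linearr ^~ a) (star_inf_linearr a)
  (star_infP a) (star_infP b c).
have h2 := lin_cvg _ _ _ _ (star_linearl ^~ c) (star_inf_linearl c)
  (star_infP ^~ c) (star_infP a b).
apply: mcvg_unique h1 _.
have -> : (fun t => star t a (star t b c)) = (fun t => star t (star t a b) c).
  by apply/funext => t; exact: starA.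
exact: h2.
Qed.

Lemma Lambda_infE a b rho : a \is hermsymmx -> b \is hermsymmx -> is_density rho ->
  Lambda_inf rho (d_expect a) (d_expect b) = expect (lie_of star_inf a b) rho.
Proof.
move=> ha hb hr; apply: (cvg_unique (@Rhausdorff R) (lie_star_cvg ha hb hr)).
(* The difference is written as a linear combination so that [mcvgD] and [mcvgZ] apply. *)
have lieE S : lie_of S a b = (- ('i / 2)) *: (S a b + (-1) *: S b a).
  by rewrite scaleN1r.
have h : mcvg +oo (fun t => rho *m lie_of (star t) a b) (rho *m lie_of star_inf a b).
  have -> : (fun t => rho *m lie_of (star t) a b) =
      (fun t => rho *m ((- ('i / 2)) *: (star t a b + (-1) *: star t b a))).
    by apply/funext => t; rewrite lieE.
  rewrite lieE.
  apply: mcvgM; first exact: mcvg_cst.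
  apply: mcvgZ; first exact: ccvg_cst.
  apply: mcvgD; first exact: star_infP.
  apply: mcvgZ; first exact: ccvg_cst.
  exact: star_infP.
by case: (mcvg_trace h).
Qed.

Lemma R_infE a b rho : a \is hermsymmx -> b \is hermsymmx -> is_density rho ->
  R_inf rho (d_expect a) (d_expect b) + expect a rho * expect b rho
    = expect (jordan_of star_inf a b) rho.
Proof.
move=> ha hb hr; apply: (cvg_unique (@Rhausdorff R) (jordan_star_cvg ha hb hr)).
have h : mcvg +oo (fun t => rho *m jordan_of (star t) a b)
                  (rho *m jordan_of star_inf a b).
  apply: mcvgM; first exact: mcvg_cst.
  apply: mcvgZ; first exact: ccvg_cst.
  by apply: mcvgD; exact: star_infP.
by case: (mcvg_trace h).
Qed.

End Heisenberg.

(** * Lie-Jordan identities in an associative algebra *)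

Section LieJordanIdentities.
Variables (K : comNzRingType) (m n : nat) (k h : K).
Local Notation mx := 'M[K]_(m, n).
Variable S : mx -> mx -> mx.
Hypothesis S_linl : forall b, linear (S ^~ b).
Hypothesis S_linr : forall a, linear (S a).
Hypothesis SA : associative S.
Implicit Types a b c : mx.

(** The scalars are arbitrary; [k = - ('i / 2)] and [h = 1 / 2] give [lie_of S] and
    [jordan_of S]. *)
Let C a b := k *: (S a b - S b a).
Let J a b := h *: (S a b + S b a).

Let SDl a b c : S (a + b) c = S a c + S b c.
Proof. by have := S_linl c 1 a b; rewrite !scale1r. Qed.

Let SDr a b c : S a (b + c) = S a b + S a c.
Proof. by have := S_linr a 1 b c; rewrite !scale1r. Qed.

Let SZl z a b : S (z *: a) b = z *: S a b.
Proof. exact: (scalable_linear (S_linl b)). Qed.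

Let SZr z a b : S a (z *: b) = z *: S a b.
Proof. exact: (scalable_linear (S_linr a)). Qed.

Let SNl a b : S (- a) b = - S a b.
Proof. by rewrite -scaleN1r SZl scaleN1r. Qed.

Let SNr a b : S a (- b) = - S a b.
Proof. by rewrite -scaleN1r SZr scaleN1r. Qed.

(** Rewriting with these rules expands nested brackets into combinations of left-associated words,
    after which each identity is polynomial in their entries. *)
Let SE := (SDl, SDr, SZl, SZr, SNl, SNr, SA).

Lemma comm_linearr a : linear (C a).
Proof. by move=> z u v; rewrite /C !SE; apply/matrixP => i j; rewrite !mxE; ring. Qed.

Lemma anti_linearr a : linear (J a).
Proof. by move=> z u v; rewrite /J !SE; apply/matrixP => i j; rewrite !mxE; ring. Qed.

Lemma comm_jacobi a b c : C a (C b c) + C b (C c a) + C c (C a b) = 0.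
Proof. by rewrite /C !SE; apply/matrixP => i j; rewrite !mxE; ring. Qed.

Lemma anti_jordan_identity a b : J (J a b) (J a a) = J a (J b (J a a)).
Proof. by rewrite /J !SE; apply/matrixP => i j; rewrite !mxE; ring. Qed.

Lemma comm_derivation a b c : C a (J b c) = J (C a b) c + J b (C a c).
Proof. by rewrite /C /J !SE; apply/matrixP => i j; rewrite !mxE; ring. Qed.

(** The words abc and cba cancel on each side. What remains is acb + bca - bac - cab, with factor
    [h * h] on the left and [- (k * k)] on the right. *)
Lemma comm_anti_associator a b c : k * k = - (h * h) ->
  J a (J b c) - J (J a b) c = C a (C b c) - C (C a b) c.
Proof.
by move=> kh; rewrite /C /J !SE; apply/matrixP => i j; rewrite !mxE; ring: kh.
Qed.

End LieJordanIdentities.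

(** * Transfer of a limit product to expectation functions and their complexification *)

Section ExpectationAlgebra.
Variables (R : realType) (n : nat).
Local Notation mx := 'M[R[i]]_n.
Local Notation E := (expectations R n).

Fact expectationP (f : E) :
  exists a : observable R n, forall rho, f rho = expect (sval a) (sval rho).
Proof. by have /asboolP := valP f. Qed.

Definition observable_of (f : E) : mx := sval (projT1 (cid (expectationP f))).

Lemma observable_of_herm f : observable_of f \is hermsymmx.
Proof. exact: (svalP (projT1 (cid (expectationP f)))). Qed.

Lemma expectationE (f : E) rho : f rho = expect (observable_of f) (sval rho).
Proof. by rewrite /observable_of; case: cid. Qed.

(** Densities span, and on Hermitian matrices the real number [expect] is the full trace. Hence the
    observable chosen for an expectation function is unique. *)
Lemma expect_density_inj (a b : mx) : a \is hermsymmx -> b \is hermsymmx ->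
  (forall rho, is_density rho -> expect a rho = expect b rho) -> a = b.
Proof.
move=> ha hb hab; apply: trace_inj; apply: density_ind => [z u v hu hv||rho hr].
- by rewrite !mulmxDl -!scalemxAl !mxtraceD !mxtraceZ hu hv.
- by rewrite !mul0mx.
- by case: (hr) => hr' _ _; rewrite !trace_expect // hab.
Qed.

Lemma observable_ofP (f : E) a : a \is hermsymmx ->
  (forall rho, f rho = expect a (sval rho)) -> observable_of f = a.
Proof.
move=> ha fa; apply: (expect_density_inj (observable_of_herm f) ha) => rho hr.
by have := fa (exist _ rho hr); rewrite expectationE.
Qed.

Lemma observable_of_inj : injective observable_of.
Proof. by move=> f g fg; apply/val_inj/funext => rho; rewrite /= !expectationE fg. Qed.

Lemma observable_of_expectation a : observable_of (expectation_of a) = sval a.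
Proof. exact: (observable_ofP (svalP a)). Qed.

Lemma observable_of_linear (r : R) f g :
  observable_of (r *: f + g) = r%:C *: observable_of f + observable_of g.
Proof.
apply: observable_ofP => [|rho]; first by apply: hermDZ; exact: observable_of_herm.
by rewrite expectDl expectZl -!expectationE.
Qed.

Lemma observable_ofD f g : observable_of (f + g) = observable_of f + observable_of g.
Proof. by have := observable_of_linear 1 f g; rewrite !scale1r. Qed.

Lemma observable_of0 : observable_of 0 = 0.
Proof. by apply: (addIr (observable_of 0)); rewrite -observable_ofD !add0r. Qed.

Lemma observable_ofZ r f : observable_of (r *: f) = r%:C *: observable_of f.
Proof. by have := observable_of_linear r f 0; rewrite observable_of0 !addr0. Qed.

Lemma observable_ofN f : observable_of (- f) = - observable_of f.
Proof. by rewrite -scaleN1r observable_ofZ rmorphN1 scaleN1r. Qed.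

Variable S : mx -> mx -> mx.
Hypothesis S_linl : forall b, linear (S ^~ b).
Hypothesis S_linr : forall a, linear (S a).
Hypothesis SA : associative S.
Hypothesis S_adj : forall a b, (S a b) ^t* = S (b ^t*) (a ^t*).

Definition expectation_lie (f g : E) : E :=
  expectation_of (exist (fun a => a \is hermsymmx) _
    (lie_of_herm S_adj (observable_of_herm f) (observable_of_herm g))).

Definition expectation_jordan (f g : E) : E :=
  expectation_of (exist (fun a => a \is hermsymmx) _
    (jordan_of_herm S_adj (observable_of_herm f) (observable_of_herm g))).

Lemma observable_of_lie f g : observable_of (expectation_lie f g)
  = lie_of S (observable_of f) (observable_of g).
Proof. exact: observable_of_expectation. Qed.

Lemma observable_of_jordan f g : observable_of (expectation_jordan f g)
  = jordan_of S (observable_of f) (observable_of g).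
Proof. exact: observable_of_expectation. Qed.

Lemma expectation_lie_jordan : is_lie_jordan expectation_lie expectation_jordan.
Proof.
have lieN f g : expectation_lie f g = - expectation_lie g f.
  apply: observable_of_inj.
  by rewrite observable_ofN !observable_of_lie /lie_of -scalerN opprB.
have i2 : 'i * 'i = -1 :> R[i] by rewrite -expr2 sqr_i.
have lie_lin f : linear (expectation_lie f).
  move=> r g h; apply: observable_of_inj.
  by rewrite observable_of_lie !observable_of_linear !observable_of_lie; exact: comm_linearr.
have jor_comm f g : expectation_jordan f g = expectation_jordan g f.
  by apply: observable_of_inj; rewrite !observable_of_jordan /jordan_of addrC.
have jor_lin f : linear (expectation_jordan f).
  move=> r g h; apply: observable_of_inj.
  by rewrite observable_of_jordan !observable_of_linear !observable_of_jordan; exact: anti_linearr.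
split.
- split=> // f r g h; rewrite lieN lie_lin.
  by rewrite [expectation_lie g f]lieN [expectation_lie h f]lieN scalerN -opprD.
- move=> f; apply: observable_of_inj.
  by rewrite observable_of_lie /lie_of subrr scaler0 observable_of0.
- move=> f g h; apply: observable_of_inj.
  rewrite !(observable_ofD, observable_of_lie) observable_of0; exact: comm_jacobi.
- by split=> // f r g h; rewrite !(jor_comm _ f) jor_lin.
- exact: jor_comm.
- move=> f g; apply: observable_of_inj.
  rewrite !observable_of_jordan; exact: anti_jordan_identity.
- move=> f g h; apply: observable_of_inj.
  rewrite !(observable_ofD, observable_of_lie, observable_of_jordan).
  exact: comm_derivation.
(* [mu = 1] works because the squares of [- ('i / 2)] and [1 / 2] are opposite. *)
- exists 1 => [|f g h]; first exact: oner_neq0.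
  apply: observable_of_inj; rewrite expr1n scale1r.
  rewrite !(observable_ofD, observable_ofN, observable_of_lie, observable_of_jordan).
  by apply: comm_anti_associator => //; field: i2.
Qed.

Definition operator_of (x : complexification E) : mx :=
  observable_of x.1 + 'i *: observable_of x.2.

Lemma operator_of_linear : linear operator_of.
Proof.
have i2 : 'i * 'i = -1 :> R[i] by rewrite -expr2 sqr_i.
move=> [p q] [f g] [f' g']; rewrite /operator_of /=.
rewrite !(observable_ofD, observable_ofN, observable_ofZ).
have -> : (p +i* q) = p%:C + 'i * q%:C by congr (_ +i* _) => /=; ring.
by apply/matrixP => i j; rewrite !mxE; ring: i2.
Qed.

Lemma operator_of_complexify f : operator_of (complexify f) = observable_of f.
Proof. by rewrite /operator_of observable_of0 scaler0 addr0. Qed.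

(** The adjoint of x + i y, with x and y Hermitian, is x - i y; together these two matrices
    determine x and y. *)
Lemma operator_of_inj : injective operator_of.
Proof.
have herm f := hermP _ (observable_of_herm f).
have adj x : (operator_of x) ^t* = observable_of x.1 - 'i *: observable_of x.2.
  by rewrite /operator_of adjD Defs.adjZ !herm conj_i scaleNr.
move=> [f g] [f' g'] xy.
have yx : observable_of f - 'i *: observable_of g
    = observable_of f' - 'i *: observable_of g'.
  have h := congr1 (fun a : mx => a ^t*) xy.
  exact: etrans (esym (adj (f, g))) (etrans h (adj (f', g'))).
move: xy; rewrite /operator_of /= => xy.
have i0 : 'i != 0 :> R[i] by exact: neq0Ci.
congr pair; apply: observable_of_inj.
  have E (u v : mx) : 2 *: u = (u + v) + (u - v).
    by rewrite addrACA subrr addr0 scaler_nat mulr2n.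
  apply: (scalerI (_ : 2 != 0 :> R[i])); first by rewrite pnatr_eq0.
  by rewrite (E _ ('i *: observable_of g)) xy yx -E.
have E (u v : mx) : (2 * 'i) *: v = (u + 'i *: v) - (u - 'i *: v).
  by rewrite opprB addrC addrA subrK -scalerA scaler_nat mulr2n.
apply: (scalerI (_ : 2 * 'i != 0 :> R[i])).
  by rewrite mulf_neq0 // pnatr_eq0.
by rewrite (E (observable_of f)) xy yx -E.
Qed.

Lemma operator_of_surj a : exists x, operator_of x = a.
Proof.
move: a; apply: herm_ind => [z u v [x <-] [y <-]|a ha].
  by exists (z *: x + y); rewrite operator_of_linear.
exists (complexify (expectation_of (exist (fun a => a \is hermsymmx) a ha))).
by rewrite operator_of_complexify observable_of_expectation.
Qed.

(** The complexification is in linear bijection with all matrices through [operator_of], and [S] is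
    carried back along it. *)
Lemma expectation_associative :
  gives_associative_algebra expectation_lie expectation_jordan.
Proof.
have [star starE] : exists star : complexification E -> complexification E ->
    complexification E, forall x y, operator_of (star x y) = S (operator_of x) (operator_of y).
  exists (fun x y => projT1 (cid (operator_of_surj (S (operator_of x) (operator_of y))))).
  by move=> x y; case: cid.
exists star; split.
- split=> [x z u v|y z u v]; apply: operator_of_inj.
    by rewrite operator_of_linear !starE operator_of_linear S_linr.
  by rewrite operator_of_linear !starE operator_of_linear S_linl.
- move=> f g; apply: operator_of_inj.
  rewrite starE (addrC (complexify _)) operator_of_linear !operator_of_complexify.
  by rewrite observable_of_lie observable_of_jordan addrC jordan_lie_of.
- move=> x y z; apply: operator_of_inj.
  by rewrite !starE SA.
Qed.

End ExpectationAlgebra.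

(** * Linearity, trace and adjoint properties of the generator *)

Section KossakowskiLindblad.
Variables (R : realType) (n : nat).
Local Notation mx := 'M[R[i]]_n.
Variables (H : mx) (V : 'I_(n ^ 2 - 1) -> mx).
Local Notation L := (kossakowski_lindblad H V).

Lemma kossakowski_lindblad_linear : linear L.
Proof.
have sumD (f g h : 'I_(n ^ 2 - 1) -> mx) z :
    (forall j, f j = z *: g j + h j) -> \sum_j f j = z *: \sum_j g j + \sum_j h j.
  by move=> E; rewrite scaler_sumr -big_split; apply: eq_bigr => j _; rewrite E.
move=> z u v; rewrite /kossakowski_lindblad.
rewrite (sumD (fun j => V j *m (z *: u + v) *m (V j) ^t*)
  (fun j => V j *m u *m (V j) ^t*) (fun j => V j *m v *m (V j) ^t*) z); last first.
  by move=> j /=; rewrite mulmxDr mulmxDl -scalemxAr -scalemxAl.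
rewrite (sumD (fun j => (V j) ^t* *m V j *m (z *: u + v) + (z *: u + v) *m (V j) ^t* *m V j)
  (fun j => (V j) ^t* *m V j *m u + u *m (V j) ^t* *m V j)
  (fun j => (V j) ^t* *m V j *m v + v *m (V j) ^t* *m V j) z); last first.
  by move=> j /=; rewrite mulmxDr !mulmxDl -!scalemxAr -!scalemxAl addrACA scalerDr.
rewrite mulmxDr mulmxDl -scalemxAr -scalemxAl.
move: (H *m u) (H *m v) (u *m H) (v *m H) => a b c d.
move: (\sum_j _) (\sum_j _) (\sum_j _) (\sum_j _) => A B C D.
by apply/matrixP => i j; rewrite !mxE; ring.
Qed.

(** By cyclicity the commutator has trace 0, and for each [j] the two halved dissipative terms and
    the jump term all have the same trace. *)
Lemma kossakowski_lindblad_trace (rho : mx) : \tr (L rho) = 0.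
Proof.
have trB (u v : mx) : \tr (u - v) = \tr u - \tr v by exact: raddfB.
rewrite /kossakowski_lindblad mxtraceD trB !mxtraceZ trB.
rewrite (mxtrace_mulC H) subrr mulr0 sub0r !linear_sum /=.
rewrite mulr_sumr -sumrN -big_split big1 //= => j _.
rewrite mxtraceD -[rho *m _ *m _]mulmxA (mxtrace_mulC rho).
rewrite -[V j *m rho *m _]mulmxA (mxtrace_mulC (V j)) -[rho *m _ *m _]mulmxA.
by rewrite (mxtrace_mulC rho); field.
Qed.

Lemma kossakowski_lindblad_adj (H_herm : H \is hermsymmx) (rho : mx) :
  L (rho ^t*) = (L rho) ^t*.
Proof.
have adj_sum (f : 'I_(n ^ 2 - 1) -> mx) : (\sum_j f j) ^t* = \sum_j (f j) ^t*.
  apply: (big_morph (fun u : mx => u ^t*) (@adjD R n)).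
  exact/hermP/herm0.
have adjN (u : mx) : (- u) ^t* = - u ^t* by rewrite linearN map_mxN.
have conjNi : Num.conj (- 'i : R[i]) = 'i by rewrite rmorphN /= conj_i opprK.
have half : Num.conj (1 / 2 : R[i]) = 1 / 2 by rewrite mul1r -half_real conj_real.
have E1 : (- 'i) *: (H *m rho ^t* - rho ^t* *m H)
    = ((- 'i) *: (H *m rho - rho *m H)) ^t*.
  rewrite Defs.adjZ conjNi adjD adjN !adj_mulmx (hermP _ H_herm).
  by rewrite scaleNr -scalerN opprB.
have E2 : (1 / 2) *: \sum_j ((V j) ^t* *m V j *m rho ^t* + rho ^t* *m (V j) ^t* *m V j)
    = ((1 / 2) *: \sum_j ((V j) ^t* *m V j *m rho + rho *m (V j) ^t* *m V j)) ^t*.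
  rewrite Defs.adjZ half adj_sum; congr (_ *: _); apply: eq_bigr => j _.
  by rewrite adjD !adj_mulmx trmxCK addrC !mulmxA.
have E3 : \sum_j (V j *m rho ^t* *m (V j) ^t*) = (\sum_j (V j *m rho *m (V j) ^t*)) ^t*.
  by rewrite adj_sum; apply: eq_bigr => j _; rewrite !adj_mulmx trmxCK mulmxA.
by rewrite /kossakowski_lindblad E1 E2 E3 !(adjD, adjN).
Qed.

HB.instance Definition _ :=
  GRing.isLinear.Build _ _ _ _ L kossakowski_lindblad_linear.

End KossakowskiLindblad.

Theorem theorem5p3 (R : realType) (n : nat)
    (H : 'M[R[i]]_n) (V : 'I_(n ^ 2 - 1) -> 'M[R[i]]_n)
    (H_herm : H \is hermsymmx) (H_tr : \tr H = 0)
    (V_tr : forall j, \tr (V j) = 0)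
    (V_orth : forall j k, j != k -> \tr ((V j) ^t* *m V k) = 0)
    (Lambda_inf R_inf : tensor20 R n) :
  let L := kossakowski_lindblad H V in
  tensor_cvg (flow_pushforward L (@Lambda_D R n)) Lambda_inf ->
  tensor_cvg (flow_pushforward L (@R_D R n)) R_inf ->
  exists lie jor : expectations R n -> expectations R n -> expectations R n,
    [/\ forall (a b : observable R n) (rho : density R n),
          lie (expectation_of a) (expectation_of b) rho
            = Lambda_inf (sval rho) (d_expect (sval a)) (d_expect (sval b)),
        forall (a b : observable R n) (rho : density R n),
          jor (expectation_of a) (expectation_of b) rho
            = R_inf (sval rho) (d_expect (sval a)) (d_expect (sval b))
              + expectation_of a rho * expectation_of b rho,
        is_lie_jordan lie jor
      & gives_associative_algebra lie jor].

Proof.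
move=> L Lambda_cvg R_cvg.
have L_tr := kossakowski_lindblad_trace H V.
have L_adj := kossakowski_lindblad_adj V H_herm.
have S_linl := star_inf_linearl L_tr L_adj Lambda_cvg R_cvg.
have S_linr := star_inf_linearr L_tr L_adj Lambda_cvg R_cvg.
have SA := star_infA L_tr L_adj Lambda_cvg R_cvg.
have S_adj := star_inf_adj L_tr L_adj Lambda_cvg R_cvg.
(* Both brackets come from the single limit product [star_inf]; [Lambda_infE] and [R_infE] identify
   them with the limit tensors. *)
exists (expectation_lie S_adj), (expectation_jordan S_adj); split.
- move=> a b rho; rewrite expectationE observable_of_lie !observable_of_expectation.
  by rewrite (Lambda_infE L_tr L_adj Lambda_cvg R_cvg (svalP a) (svalP b) (svalP rho)).
- move=> a b rho; rewrite expectationE observable_of_jordan !observable_of_expectation.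
  by rewrite -(R_infE L_tr L_adj Lambda_cvg R_cvg (svalP a) (svalP b) (svalP rho)).
- exact: expectation_lie_jordan.
- exact: expectation_associative.
Qed.
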